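(* Let $\mathcal{C}$ be a fully expressive representation language for Boolean functions and let $\mathsf{p}:\mathcal{C}\rightarrow \mathbb{N}$ be a parameter. Assume that for every Boolean function $f$ and every $C\in \mathcal{C}$ that encodes $f$ there is a complete structured DNNF $D$ computing $f$ with $\mathsf{wi}(D) \le 2^{\mathsf{p}(C)}$. Then for every Boolean function $f$ and every $C\in\mathcal{C}$ encoding $f$ we have $\mathsf{p}(C) \ge \mathsf{cc_{best}^{1/3}}(f)$.
   Context: A representation language is a class $\mathcal{C}$ of objects each of which encodes a Boolean function; it is fully expressive if every Boolean function is encoded by some element of $\mathcal{C}$. All logarithms are base 2. A v-tree for a finite variable set $X$ is a full binary rooted tree whose leaves are in bijection with $X$ (the variable assigned to a leaf is its label); for a node $t$, $T_t$ is the subtree rooted at $t$ and $\mathsf{var}(T_t)$ is the set of labels of leaves of $T_t$. A complete structured DNNF $D$ structured by a v-tree $T$ is a Boolean circuit whose input gates are literals $x$ or $\neg x$ (no constant inputs), whose $\land$-gates have exactly two inputs and whose $\lor$-gates have arbitrary fan-in, together with a labeling $\mu$ of the nodes of $T$ by sets of gates such that: every gate $g$ lies in $\mu(t_g)$ for a unique node $t_g$; if $t$ is a leaf labeled $x$ then $\mu(t)\subseteq\{x,\neg x\}$, and for every input gate $g$ the node $t_g$ is a leaf; every input of an $\lor$-gate $g$ is an $\land$-gate in $\mu(t_g)$; every $\land$-gate $g$ has exactly two inputs $g_1,g_2$, each an $\lor$-gate or input gate, and $t_{g_1},t_{g_2}$ are the two children of $t_g$ in $T$. The width $\mathsf{wi}(D)$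 is the maximum number of $\lor$-gates in a single set $\mu(t)$. For a Boolean function $f$ on variables $X$ and a partition $\Pi=(Y,Z)$ of $X$, a combinatorial rectangle respecting $\Pi$ is a function of the form $r_1(Y)\land r_2(Z)$; a rectangle cover of $f$ of size $s$ respecting $\Pi$ is a representation $f=\bigvee_{i=1}^s r_1^i(Y)\land r_2^i(Z)$ by such rectangles. $\mathsf{cc}(f,\Pi)=\log s_{\min}$ where $s_{\min}$ is the minimum size of a rectangle cover of $f$ respecting $\Pi$. $\mathsf{cc_{best}^{1/3}}(f)=\min_{\Pi}\mathsf{cc}(f,\Pi)$, the minimum over all partitions $(Y,Z)$ of $X$ with $\min(|Y|,|Z|)\ge |X|/3$.
   Formalization: The assumption and the conclusion are restricted to Boolean functions on at least 3 variables: one-variable constants have no complete structured DNNF, and XOR of two variables has one of width 1 although its cc_best^{1/3} is 1. *)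

(* Defs.v *)
From HB Require Import structures.
From mathcomp Require Import all_boot all_order all_algebra finmap.
From mathcomp Require Import all_classical all_reals all_analysis.

Set Implicit Arguments.
Unset Strict Implicit.
Unset Printing Implicit Defensive.

Definition assignment (X : finType) := {ffun X -> bool}.

Definition bfun (X : finType) := {ffun assignment X -> bool}.

(* A Boolean function together with its finite set of variables, which are
   drawn from an arbitrary universe V. *)
Record boolean_function (V : choiceType) := BooleanFunction {
  vars : {fset V};
  fn : bfun vars
}.

(* A representation language is a type C with a map enc sending every object
   to the Boolean function it encodes. *)
Definition fully_expressive (V : choiceType) (C : Type)
    (enc : C -> boolean_function V) : Prop :=
  forall f : boolean_function V, exists c : C, enc c = f.

(** ** V-trees *)

Inductive vtree (X : Type) : Type :=
| Leaf of X
| Branch of vtree X & vtree X.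

Fixpoint leaves (X : Type) (T : vtree X) : seq X :=
  match T with
  | Leaf x => [:: x]
  | Branch l r => leaves l ++ leaves r
  end.

Definition vtree_for (X : finType) (T : vtree X) : bool :=
  perm_eq (leaves T) (enum X).

(* A node is addressed by its path from the root (false: left child,
   true: right child), so the children of t are rcons t false, rcons t true. *)
Definition node := seq bool.

Fixpoint nodes (X : Type) (T : vtree X) : seq node :=
  [::] :: match T with
          | Leaf _ => [::]
          | Branch l r => map (cons false) (nodes l) ++ map (cons true) (nodes r)
          end.

Fixpoint subtree (X : Type) (T : vtree X) (t : node) : option (vtree X) :=
  match t, T with
  | [::], _ => Some T
  | b :: t', Branch l r => subtree (if b then r else l) t'
  | _ :: _, Leaf _ => None
  end.

(** ** Circuits *)

(* [Lit x true] is the literal x and [Lit x false] the literal ~x.  The fan-in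
   of an or-gate may be 0; an unsatisfiable function needs such a gate, because
   there are no constant inputs. *)
Inductive gate_label (X G : finType) : Type :=
| Lit of X & bool
| And of G & G
| Or of {set G}.

Arguments Lit {X G}.
Arguments And {X G}.
Arguments Or {X G}.

Definition is_lit (X G : finType) (k : gate_label X G) : bool :=
  if k is Lit _ _ then true else false.
Definition is_and (X G : finType) (k : gate_label X G) : bool :=
  if k is And _ _ then true else false.
Definition is_or (X G : finType) (k : gate_label X G) : bool :=
  if k is Or _ then true else false.

Definition inputs (X G : finType) (k : gate_label X G) : {set G} :=
  match k with
  | Lit _ _ => finset.set0
  | And g1 g2 => [set g1; g2]%SET
  | Or A => A
  end.

Record circuit (X : finType) := Circuit {
  gate : finType;
  label : gate -> gate_label X gate;
  output : gate;
  acyclic : well_founded (fun h g => h \in inputs (label g))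
}.

Definition gate_value (X G : finType) (a : assignment X) (v : G -> bool)
    (k : gate_label X G) : bool :=
  match k with
  | Lit x b => a x == b
  | And g1 g2 => v g1 && v g2
  | Or A => [exists h in A, v h]
  end.

(* By acyclicity, every assignment has exactly one such v. *)
Definition evaluation (X : finType) (D : circuit X) (a : assignment X)
    (v : gate D -> bool) : Prop :=
  forall g, v g = gate_value a v (label g).

Definition computes (X : finType) (D : circuit X) (f : bfun X) : Prop :=
  forall a, exists2 v, evaluation a v & v (output D) = f a.

(** ** Complete structured DNNFs *)

(* The labeling mu is given by the map sending a gate g to the unique node
   t_g with g \in mu t_g. *)
Definition mu (G : finType) (node_of : G -> node) (t : node) : {set G} :=
  [set g | node_of g == t]%SET.

Record structured_by (X : finType) (T : vtree X) (D : circuit X)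
    (node_of : gate D -> node) : Prop := StructuredBy {
  gate_node : forall g, node_of g \in nodes T;
  leaf_gates : forall t x, subtree T t = Some (Leaf x) ->
    forall g, g \in mu node_of t -> exists b, label g = Lit x b;
  input_gates : forall g, is_lit (label g) ->
    exists x, subtree T (node_of g) = Some (Leaf x);
  or_gates : forall g A, label g = Or A ->
    forall h, h \in A -> is_and (label h) /\ h \in mu node_of (node_of g);
  and_gates : forall g g1 g2, label g = And g1 g2 ->
    [/\ is_or (label g1) || is_lit (label g1),
        is_or (label g2) || is_lit (label g2)
      & exists b, node_of g1 = rcons (node_of g) b /\
                  node_of g2 = rcons (node_of g) (~~ b)]
}.

Record csdnnf (X : finType) := CompleteStructuredDNNF {
  tree : vtree X;
  tree_for : vtree_for tree;
  circ :> circuit X;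
  node_of : gate circ -> node;
  structured : structured_by tree node_of
}.

Definition width (X : finType) (D : csdnnf X) : nat :=
  \max_(t <- nodes (tree D))
     #|[set g in mu (@node_of X D) t | is_or (label g)]%SET|.

(** ** Rectangle covers *)

(* A partition (Y, Z) of X is represented by Y, with Z the complement ~: Y. *)

Definition restrict (X : finType) (Y : {set X}) (a : assignment X) :
  assignment {x : X | x \in Y} := [ffun y => a (val y)].

Definition is_rectangle_cover (X : finType) (f : bfun X) (Y : {set X}) (s : nat)
    (r1 : {ffun 'I_s -> bfun {x : X | x \in Y}})
    (r2 : {ffun 'I_s -> bfun {x : X | x \in ~: Y}}) : bool :=
  [forall a, f a == [exists i, r1 i (restrict Y a) && r2 i (restrict (~: Y) a)]].

Definition has_cover (X : finType) (f : bfun X) (Y : {set X}) (s : nat) : bool :=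
  [exists r1, exists r2, @is_rectangle_cover X f Y s r1 r2].

Lemma has_cover_ex (X : finType) (f : bfun X) (Y : {set X}) :
  exists s, has_cover f Y s.
Proof.
exists #|[set a | f a]%SET|.
pose m (i : 'I_#|[set a | f a]%SET|) := enum_val i.
apply/existsP; exists [ffun i => [ffun b => b == restrict Y (m i)]].
apply/existsP; exists [ffun i => [ffun b => b == restrict (~: Y) (m i)]].
apply/forallP => a; apply/eqP; apply/idP/existsP => [fa | [i]].
  have ha : a \in [set a | f a]%SET by rewrite inE.
  by exists (enum_rank_in ha a); rewrite !ffunE /m enum_rankK_in// !eqxx.
rewrite !ffunE => /andP[/eqP e1 /eqP e2].
suff -> : a = m i by have := enum_valP i; rewrite inE.
apply/ffunP => x; case: (boolP (x \in Y)) => hx.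
  by have /ffunP/(_ (exist _ x hx)) := e1; rewrite !ffunE.
have hx' : x \in ~: Y by rewrite inE.
by have /ffunP/(_ (exist _ x hx')) := e2; rewrite !ffunE.
Qed.

Definition min_cover (X : finType) (f : bfun X) (Y : {set X}) : nat :=
  ex_minn (has_cover_ex f Y).

(* Extended-real valued, with log 0 = -oo: the constant 0 has a cover of
   size 0. *)
Definition log2e (R : realType) (s : nat) : \bar R :=
  (lne (s%:R)%R%:E * ((ln 2)^-1)%R%:E)%E.

Definition cc (R : realType) (X : finType) (f : bfun X) (Y : {set X}) : \bar R :=
  log2e R (min_cover f Y).

Definition balanced (X : finType) (Y : {set X}) : bool :=
  #|X| <= 3 * minn #|Y| #|~: Y|.

(* The neutral element +oo is attained only when there is no balanced
   partition, i.e. for #|X| = 1. *)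
Definition cc_best_third (R : realType) (X : finType) (f : bfun X) : \bar R :=
  \big[mine/+oo%E]_(Y : {set X} | balanced Y) cc R f Y.

(* Main.v *)
(* Some internal node t of the v-tree has between n/3 and 2n/3 of the n >= 3
   leaves below it.  If the output gate sits strictly above t, every proof tree
   of an accepted assignment passes through exactly one or-gate g at t: the part
   below g reads only var(T_t) and the part above g only the other variables, so
   the or-gates at t index a rectangle cover.  Otherwise the function depends on
   one side of the partition only and a single rectangle suffices. *)

Require Import Defs.
From mathcomp Require Import all_boot all_order all_algebra finmap.
From mathcomp Require Import all_classical all_reals all_analysis.
From mathcomp Require Import zify.

Set Implicit Arguments.
Unset Strict Implicit.
Unset Printing Implicit Defensive.

Import Order.TTheory GRing.Theory Num.Theory.

(** ** Addresses in v-trees *)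

(** An address outside the tree gets the empty list, so inclusions between leaf lists need no
    validity hypothesis. *)
Definition leaves_at (X : Type) (T : vtree X) (t : node) : seq X :=
  oapp (@leaves X) [::] (subtree T t).

Lemma subtree_nil (X : Type) (T : vtree X) : subtree T [::] = Some T.
Proof. by case: T. Qed.

Lemma subtree_cat (X : Type) (T : vtree X) s t :
  subtree T (s ++ t) = obind (fun S => subtree S t) (subtree T s).
Proof.
elim: s T => [|b s IH] T; first by rewrite subtree_nil.
by case: T => [x|l r] //=; rewrite IH.
Qed.

Lemma leaves_at_cons (X : Type) (l r : vtree X) b t :
  leaves_at (Branch l r) (b :: t) = leaves_at (if b then r else l) t.
Proof. by []. Qed.

Lemma leaves_at_nil (X : Type) (T : vtree X) : leaves_at T [::] = leaves T.
Proof. by rewrite /leaves_at subtree_nil. Qed.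

Lemma leaves_at_sub_leaves (X : eqType) (T : vtree X) t :
  {subset leaves_at T t <= leaves T}.
Proof.
elim: t T => [|b t IH] T x; first by rewrite leaves_at_nil.
case: T => [y|l r] //; rewrite leaves_at_cons => /IH /=.
by rewrite mem_cat; case: b => ->; rewrite ?orbT.
Qed.

Lemma leaves_at_uniq (X : eqType) (T : vtree X) t :
  uniq (leaves T) -> uniq (leaves_at T t).
Proof.
elim: t T => [|b t IH] [x|l r] //=.
by rewrite cat_uniq leaves_at_cons => /and3P[? _ ?]; apply: IH; case: b.
Qed.

Lemma leaves_at_cat (X : eqType) (T : vtree X) s t :
  {subset leaves_at T (s ++ t) <= leaves_at T s}.
Proof.
move=> x; rewrite /leaves_at subtree_cat; case: (subtree T s) => //= S.
exact: leaves_at_sub_leaves.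
Qed.

(** The two addresses part at [p], and sibling subtrees share no label because the leaves of [T] are
    distinct. *)
Lemma leaves_at_disjoint (X : eqType) (T : vtree X) p b s s' x :
  uniq (leaves T) -> x \in leaves_at T (p ++ b :: s) ->
  x \notin leaves_at T (p ++ ~~ b :: s').
Proof.
elim: p T => [|c p IH] [y|l r] //=; rewrite cat_uniq => /and3P[ul hlr ur].
  rewrite !leaves_at_cons; case: b => /= /leaves_at_sub_leaves hx;
    apply/negP => /leaves_at_sub_leaves hx'; case/negP: hlr; apply/hasP;
    by exists x.
by rewrite !leaves_at_cons; apply: IH; case: (c).
Qed.

Lemma mem_nodes (X : Type) (T : vtree X) t : (t \in nodes T) = (subtree T t : bool).
Proof.
elim: T t => [x|l IHl r IHr] [|b t] //.
rewrite [nodes _]/= in_cons mem_cat [LHS]/= [RHS]/=.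
have inj c : injective (cons c : node -> node) by move=> ? ? [].
case: b; rewrite -?IHl -?IHr (mem_map (inj _)).
  by case: mapP => // -[? _].
by rewrite orbC; case: mapP => // -[? _].
Qed.

(** With [s] the node of the output gate, these are the cases of the cover construction: output at
    or below [t], strictly above [t], or in a disjoint branch. *)
Lemma node_cases (s t : node) :
  [\/ prefix t s, exists c s', t = s ++ c :: s'
    | exists p b s' t', s = p ++ b :: s' /\ t = p ++ ~~ b :: t'].
Proof.
elim: s t => [|b s IH] [|c t]; try by constructor 1.
  by constructor 2; exists c, t.
have [->{c}|/negPf bc] := eqVneq c b; last first.
  constructor 3; exists [::], b, s, t.
  by move: b c bc => [] [].
case: (IH t) => [ts|[c [s' ->]]|[p [d [s' [t' [-> ->]]]]]].
- by constructor 1; rewrite /= eqxx.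
- by constructor 2; exists c, s'.
- by constructor 3; exists (b :: p), d, s', t'.
Qed.

(* Descend to the larger child until at most two thirds of the leaves remain. *)
Lemma balanced_node (X : Type) (T : vtree X) n :
  3 <= n -> 2 * n < 3 * size (leaves T) ->
  exists2 t, t \in nodes T &
    [/\ 1 < size (leaves_at T t), n <= 3 * size (leaves_at T t)
      & 3 * size (leaves_at T t) <= 2 * n].
Proof.
move=> n3; elim: T => [x|l IHl r IHr] /=; first lia.
rewrite size_cat => hs.
have step b : (2 * n < 3 * size (leaves (if b then r else l)) ->
    exists2 t, t \in nodes (if b then r else l) &
    [/\ 1 < size (leaves_at (if b then r else l) t),
      n <= 3 * size (leaves_at (if b then r else l) t)
      & 3 * size (leaves_at (if b then r else l) t) <= 2 * n]) ->
    size (leaves (if b then l else r)) <= size (leaves (if b then r else l)) ->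
    exists2 t, t \in nodes (Branch l r) &
    [/\ 1 < size (leaves_at (Branch l r) t),
      n <= 3 * size (leaves_at (Branch l r) t)
      & 3 * size (leaves_at (Branch l r) t) <= 2 * n].
  move=> IH le.
  (* The larger child has at least half of more than 2n/3 leaves, hence more than n/3 >= 1 of
     them. *)
  have [small|/IH[t tn ht]] := leqP (3 * size (leaves (if b then r else l))) (2 * n).
    exists [:: b]; first by rewrite mem_nodes /= subtree_nil.
    rewrite leaves_at_cons leaves_at_nil; move: small le hs.
    by case: b {IH} => small le hs; split=> //; lia.
  by exists (b :: t) => //; rewrite mem_nodes /= -mem_nodes.
by have [le|lt] := leqP (size (leaves l)) (size (leaves r));
  [apply: (step true) | apply: (step false) => //; apply: ltnW].
Qed.

(** ** Gates and the variables below them *)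

Lemma prefix_rconsl (s t : node) b : prefix (rcons s b) t -> prefix s t.
Proof. by move=> /prefixP[u ->]; rewrite cat_rcons prefix_prefix. Qed.

Lemma lit_node (X : finType) (T : vtree X) (D : circuit X) (nd : gate D -> node) :
  structured_by T nd -> forall g x b, label g = Lit x b ->
  subtree T (nd g) = Some (Leaf x).
Proof.
move=> st g x b lg.
have [|y ty] := input_gates st (g := g); first by rewrite lg.
have [|c] := leaf_gates st ty (g := g); first by rewrite inE.
by rewrite lg => -[-> _].
Qed.

(** Inputs of an or-gate stay at its node and inputs of an and-gate move to a child, so induction
    along the wires never leaves the subtree of [nd g]. *)
Lemma eval_local (X : finType) (T : vtree X) (D : circuit X)
    (nd : gate D -> node) (a a' : assignment X) (v v' : gate D -> bool) :
  structured_by T nd -> evaluation a v -> evaluation a' v' ->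
  forall g, {in leaves_at T (nd g), a =1 a'} -> v g = v' g.
Proof.
move=> st ev ev' g; elim/(well_founded_ind (@acyclic X D)): g => g IH aa'.
rewrite ev ev'; case lg: (label g) => [x b|g1 g2|A] /=.
- by rewrite aa' // /leaves_at (lit_node st lg) inE.
- have [_ _ [b [n1 n2]]] := and_gates st lg.
  have sub c : {subset leaves_at T (rcons (nd g) c) <= leaves_at T (nd g)}.
    by rewrite -cats1; apply: leaves_at_cat.
  congr (_ && _); apply: IH => [|x]; rewrite ?lg ?inE ?eqxx ?orbT ?n1 ?n2 //;
    by move=> /sub /aa'.
- apply: eq_existsb => h; case hA: (h \in A) => //=.
  have [_] := or_gates st lg hA; rewrite inE => /eqP nh.
  by apply: IH; rewrite ?lg ?nh.
Qed.

(* [via v g h] says that a proof tree of [h] with respect to the gate values [v]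
   passes through [g]; the value of [g] itself is not required to be true. *)
Inductive via (X : finType) (D : circuit X) (v : gate D -> bool) (g : gate D) :
    gate D -> Prop :=
| ViaRefl : via v g g
| ViaOr h A h' of label h = Or A & h' \in A & via v g h' : via v g h
| ViaAndl h h1 h2 of label h = And h1 h2 & via v g h1 & v h2 : via v g h
| ViaAndr h h1 h2 of label h = And h1 h2 & v h1 & via v g h2 : via v g h.

Lemma via_prefix (X : finType) (T : vtree X) (D : circuit X)
    (nd : gate D -> node) (v : gate D -> bool) g h :
  structured_by T nd -> via v g h -> prefix (nd h) (nd g).
Proof.
move=> st; elim=> {h} [|h A h' lh hA _|h h1 h2 lh _ + _|h h1 h2 lh _ _].
- exact: prefix_refl.
- by have [_] := or_gates st lh hA; rewrite inE => /eqP ->.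
- by have [_ _ [b [-> _]]] := and_gates st lh; apply: prefix_rconsl.
- by have [_ _ [b [_ ->]]] := and_gates st lh; apply: prefix_rconsl.
Qed.

(* The proof tree above [g] only reads variables outside the subtree of [g], so
   below [g] it can be replaced by a proof tree for another assignment. *)
Lemma via_exchange (X : finType) (T : vtree X) (D : circuit X)
    (nd : gate D -> node) (a a' : assignment X) (v v' : gate D -> bool) g h :
  structured_by T nd -> uniq (leaves T) -> evaluation a v -> evaluation a' v' ->
  (forall x, x \notin leaves_at T (nd g) -> a x = a' x) ->
  via v g h -> v' g -> v' h.
Proof.
move=> st uT ev ev' aa' vgh vg.
(* The off-path input of an and-gate lies in the sibling of the subtree containing [g], where [a]
   and [a'] agree. *)
have side u b h' : prefix (rcons u b) (nd g) -> nd h' = rcons u (~~ b) ->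
    v h' -> v' h'.
  move=> /prefixP[s gE] hE; rewrite (eval_local st ev ev') // => x.
  rewrite hE -cats1 => /(leaves_at_disjoint s uT); rewrite negbK => xg.
  by apply: aa'; rewrite gE cat_rcons.
elim: vgh => {h} [|h A k lh hA _ IH|h h1 h2 lh vh IH v2|h h1 h2 lh v1 vh IH] //.
- by rewrite ev' lh /=; apply/existsP; exists k; rewrite hA.
- have [_ _ [b [n1 n2]]] := and_gates st lh.
  rewrite ev' lh /= IH /=; apply: (side _ b _ _ n2 v2).
  by rewrite -n1; apply: (via_prefix st vh).
- have [_ _ [b [n1 n2]]] := and_gates st lh.
  rewrite ev' lh /= IH andbT; apply: (side (nd h) (~~ b) _ _ _ v1); rewrite ?negbK //.
  by rewrite -n2; apply: (via_prefix st vh).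
Qed.

(** Follow true gates downwards: at an and-gate exactly one input lies towards [t], at an or-gate
    some true input stays at the same node. The gate reached at [t] is no literal, since [t] has at
    least two leaves below it. *)
Lemma via_exists (X : finType) (T : vtree X) (D : circuit X)
    (nd : gate D -> node) (a : assignment X) (v : gate D -> bool) t :
  structured_by T nd -> evaluation a v -> 1 < size (leaves_at T t) ->
  forall h c s, t = nd h ++ c :: s -> v h ->
  exists g, [/\ is_or (label g), nd g = t, v g & via v g h].
Proof.
move=> st ev t2 h; elim/(well_founded_ind (@acyclic X D)): h => h IH c s tE.
rewrite ev; case lh: (label h) => [x b|g1 g2|A] /=.
- by move: t2; rewrite /leaves_at tE subtree_cat (lit_node st lh).
- move=> /andP[v1 v2].
  have [k1 k2 [b [n1 n2]]] := and_gates st lh.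
  have child k : k \in inputs (label h) -> is_or (label k) || is_lit (label k) ->
      nd k = rcons (nd h) c -> v k ->
      exists g, [/\ is_or (label g), nd g = t, v g & via v g k].
    move=> kh kk nk vk; case: s tE => [|d s] tE.
      have tk : nd k = t by rewrite nk tE cats1.
      exists k; split=> //; last exact: ViaRefl.
      case/orP: kk => // /(input_gates st)[x].
      by rewrite tk => tx; move: t2; rewrite /leaves_at tx.
    by apply: (IH _ kh d s) => //; rewrite nk cat_rcons.
  have [bc|bc] := eqVneq b c.
    have [||g [? ? ? ?]] := child g1 _ k1 _ v1; rewrite ?n1 ?bc //.
      by rewrite lh !inE eqxx.
    by exists g; split=> //; apply: ViaAndl lh _ v2.
  have [||g [? ? ? ?]] := child g2 _ k2 _ v2; rewrite ?n2 //.
  - by rewrite lh !inE eqxx orbT.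
  - by move: b c bc {n1 n2 tE child} => [] [].
  by exists g; split=> //; apply: ViaAndr lh v1 _.
- move=> /existsP[k /andP[kA vk]].
  have [_] := or_gates st lh kA; rewrite inE => /eqP nk.
  have [|||g [? ? ? ?]] := IH k _ c s; rewrite ?lh ?nk //.
  by exists g; split=> //; apply: ViaOr lh kA _.
Qed.

(** ** Rectangle covers *)

Definition extend (X : finType) (Y : {set X}) (b : assignment {x : X | x \in Y}) :
  assignment X := [ffun x => oapp b false (insub x)].

Lemma extend_restrict (X : finType) (Y : {set X}) (a : assignment X) x :
  x \in Y -> extend (Defs.restrict Y a) x = a x.
Proof. by move=> xY; rewrite ffunE insubT /= ffunE. Qed.

(** Lets rectangles be given by predicates on full assignments that ignore one side, indexed by any
    finite type. *)
Lemma has_coverI (X I : finType) (f : bfun X) (Y : {set X})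
    (r1 r2 : I -> assignment X -> bool) :
  (forall i (a a' : assignment X), {in Y, a =1 a'} -> r1 i a = r1 i a') ->
  (forall i (a a' : assignment X), {in ~: Y, a =1 a'} -> r2 i a = r2 i a') ->
  (forall a, f a = [exists i, r1 i a && r2 i a]) ->
  has_cover f Y #|I|.
Proof.
move=> loc1 loc2 fE.
apply/existsP; exists [ffun i => [ffun b => r1 (enum_val i) (extend b)]].
apply/existsP; exists [ffun i => [ffun b => r2 (enum_val i) (extend b)]].
apply/forallP => a; apply/eqP; rewrite fE.
have E1 i : r1 i (extend (Defs.restrict Y a)) = r1 i a.
  by apply: loc1 => x; apply: extend_restrict.
have E2 i : r2 i (extend (Defs.restrict (~: Y) a)) = r2 i a.
  by apply: loc2 => x; apply: extend_restrict.
apply/existsP/existsP => [[i ri]|[i]].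
  by exists (enum_rank i); rewrite !ffunE enum_rankK E1 E2.
by rewrite !ffunE E1 E2 => ri; exists (enum_val i).
Qed.

Lemma node_cover (X : finType) (D : csdnnf X) (f : bfun X) (t : node) :
  computes D f -> t \in nodes (tree D) -> 1 < size (leaves_at (tree D) t) ->
  exists2 s, s <= maxn 1 (width D) &
    has_cover f [set x in leaves_at (tree D) t]%SET s.
Proof.
move=> Df tD t2; set Y := [set x in _]%SET.
have st := structured D; set T := tree D in st tD t2 Y *.
set nd := @node_of X D in st *.
have uT : uniq (leaves T) by rewrite (perm_uniq (tree_for D)) enum_uniq.
(* [computes] only asserts that an evaluation exists; choice fixes one for each assignment. *)
pose val a := s2val (cid2 (Df a)).
have ev a : evaluation a (val a) by rewrite /val; case: cid2.
have valE a : f a = val a (output D) by rewrite /val; case: cid2.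
have f_local := eval_local st (ev _) (ev _) (g := output D).
case: (node_cases (nd (output D)) t) => [|[c [s tE]]|[p [b [s [s' [oE tE]]]]]].
- move=> /prefixP[s oE]; exists 1; first by rewrite leq_maxl.
  rewrite -card_unit.
  apply: (has_coverI (r1 := fun=> f) (r2 := fun _ _ => true)) => // [_ a a' aa'|a].
    rewrite !valE; apply: f_local => x; rewrite oE => /leaves_at_cat xt.
    by apply: aa'; rewrite inE.
  by apply/idP/existsP => [fa|[]]; rewrite ?andbT //; exists tt; rewrite fa.
(* One rectangle per or-gate at [t], so their number is at most the width. *)
- pose I := {g | g \in [set g in mu nd t | is_or (label g)]%SET}.
  exists #|{: I}|.
    rewrite card_sig /= leq_max; apply/orP; right.
    apply: leq_trans (leq_bigmax_seq t tD isT).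
    by rewrite leq_eqVlt; apply/orP; left; apply/eqP; apply: eq_card.
  have nodeI (i : I) : nd (sval i) = t.
    by case: i => g /=; rewrite !inE => /andP[/eqP].
  (* Quantifying over all [a0] that agree with [a] off [Y] makes the second factor independent of
     the variables in [Y]. *)
  apply: (has_coverI (r1 := fun (i : I) a => val a (sval i))
    (r2 := fun (i : I) a => `[< exists2 a0 : assignment X, {in ~: Y, a0 =1 a}
       & via (val a0) (sval i) (output D) >])) => [i a a' aa'|i a a' aa'|a].
  + apply: (eval_local st (ev _) (ev _)) => x; rewrite nodeI => xt.
    by apply: aa'; rewrite inE.
  + apply: asbool_equiv_eq; split=> -[a0 a0a v0]; exists a0 => // x xY.
      by rewrite a0a // aa'.
    by rewrite a0a // aa'.
  + rewrite valE; apply/idP/existsP.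
      move=> /(via_exists st (ev a) t2 tE)[g [og ng vg vgo]].
      have gI : g \in [set g in mu nd t | is_or (label g)]%SET.
        by rewrite !inE ng eqxx.
      exists (exist _ g gI) => /=; rewrite vg /=; apply/asboolP; by exists a.
    move=> [i /andP[vi /asboolP[a0 a0a vo]]].
    (* The proof tree for [a0] above the gate is glued to the true gate value under [a]. *)
    apply: (via_exchange st uT (ev a0) (ev a) _ vo vi) => x.
    by rewrite nodeI => xt; apply: a0a; rewrite !inE.
- exists 1; first by rewrite leq_maxl.
  rewrite -card_unit.
  apply: (has_coverI (r1 := fun _ _ => true) (r2 := fun=> f)) => // [_ a a' aa'|a].
    rewrite !valE; apply: f_local => x; rewrite oE => xo.
    by apply: aa'; rewrite !inE tE; apply: leaves_at_disjoint xo.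
  by apply/idP/existsP => [fa|[]] //; exists tt; rewrite fa.
Qed.

Lemma min_cover_le (X : finType) (f : bfun X) (Y : {set X}) s :
  has_cover f Y s -> min_cover f Y <= s.
Proof. by rewrite /min_cover; case: ex_minnP => m _; apply. Qed.

Lemma log2e_le (R : realType) (m k : nat) :
  m <= 2 ^ k -> (log2e R m <= k%:R%:E)%E.
Proof.
have ln2 : (0 < ln 2 :> R)%R by rewrite ln_gt0 // ltr1n.
(* For [m = 0] the logarithm is -oo and the bound is trivial. *)
case: m => [_|m mk].
  by rewrite /log2e le0_lneNy // mulNyr gtr0_sg ?invr_gt0 // mul1e leNye.
rewrite /log2e lne_EFin ?ltr0n // -EFinM lee_fin ler_pdivrMr //.
rewrite mulr_natl -lnXn // -natrX ler_ln ?posrE ?ltr0n ?expn_gt0 //.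
by rewrite ler_nat.
Qed.

Theorem theorem3 (R : realType) (V : choiceType) (C : Type)
    (enc : C -> boolean_function V) (p : C -> nat)
    (expressive : fully_expressive enc)
    (dnnf : forall (f : boolean_function V) (c : C),
       (3 <= #|` vars f|)%N -> enc c = f ->
       exists D : csdnnf (vars f), computes D (fn f) /\ (width D <= 2 ^ p c)%N) :
  forall (f : boolean_function V) (c : C),
    (3 <= #|` vars f|)%N -> enc c = f ->
    (cc_best_third R (fn f) <= (p c)%:R%:E)%E.
Proof.
move=> f c f3 cf; have [D [Df wD]] := dnnf f c f3 cf.
have sT : size (leaves (tree D)) = #|{: vars f}|.
  by rewrite (perm_size (tree_for D)) -cardE.
have uT : uniq (leaves (tree D)) by rewrite (perm_uniq (tree_for D)) enum_uniq.
have := f3; rewrite cardfE => n3.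
have [|t tD [t2 lo hi]] := balanced_node (T := tree D) n3.
  by rewrite sT; lia.
have [s sw cov] := node_cover Df tD t2.
set Y := [set x in _]%SET in cov.
have cY : #|Y| = size (leaves_at (tree D) t).
  by rewrite cardsE; apply/card_uniqP/leaves_at_uniq.
have bY : balanced Y.
  (* The upper bound 2n/3 on one side is the lower bound n/3 on the other. *)
  have arith a b n : n <= 3 * a -> 3 * a <= 2 * n -> a + b = n ->
    n <= 3 * minn a b by lia.
  by apply: arith; rewrite ?cY // -cY cardsC.
apply: le_trans (bigmin_le_cond _ _ bY) _; apply: log2e_le.
apply: leq_trans (min_cover_le cov) _; apply: leq_trans sw _.
(* The single-rectangle cases are absorbed by 1 <= 2 ^ p c. *)
by rewrite geq_max expn_gt0.
Qed.
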